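(* Up to isomorphism, there is exactly one perfect $2$-coloring $\{X_1,X_2\}$ of the Johnson graph $J(10,3)$ with quotient matrix $\begin{bmatrix} 12 & 9\\ 9 & 12\end{bmatrix}$ having a part of type $1$.
   Context: The Johnson graph $J(10,3)$ has as vertices the $3$-subsets of $[10]=\{1,\dots,10\}$; two vertices $x,y$ are adjacent when $|x\cap y|=2$. It is regular of valency $21$. A perfect $2$-coloring of $J(10,3)$ with quotient matrix $[p_{i,j}]_{1\le i,j\le 2}$ is a partition of the vertex set into two parts $X_1,X_2$ such that for all $i,j\in\{1,2\}$ every vertex in $X_i$ has exactly $p_{i,j}$ neighbors in $X_j$. Two perfect $2$-colorings (regarded as unordered partitions) are isomorphic if some automorphism of $J(10,3)$, equivalently some permutation of $[10]$ acting on $3$-subsets, maps one partition to the other. Type: for a perfect $2$-coloring with quotient matrix $\begin{bmatrix} 12 & 9\\ 9 & 12\end{bmatrix}$ and a part $X$ of it, $X$ is of type $k\in\{0,1,2\}$ if for all distinct $a,b\in[10]$ the number of $x\in[10]\setminus\{a,b\}$ with $\{a,b,x\}\in X$ is congruent to $k$ modulo $3$. *)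

(* Defs.v *)
From mathcomp Require Import all_boot all_fingroup all_algebra.

Set Implicit Arguments.
Unset Strict Implicit.
Unset Printing Implicit Defensive.

(* [n] is represented by 'I_n = {0, ..., n-1}. *)
Notation johnson n k := {x : {set 'I_n} | #|x| == k}.

(* |x ∩ y| = k - 1, stated without truncated subtraction so that the relation
   is irreflexive also for k = 0. *)
Definition johnson_adj n k (x y : johnson n k) : bool :=
  #|val x :&: val y|.+1 == k.

(* A coloring is the unordered partition P; p is a quotient matrix of P when
   it is one for some numbering X of the parts. *)
Definition perfect_coloring (T : finType) (e : rel T) m (p : 'M[nat]_m)
    (P : {set {set T}}) : Prop :=
  partition P [set: T] /\
  exists X : 'I_m -> {set T},
    [/\ injective X,
        P = [set X i | i : 'I_m] &
        forall (i j : 'I_m) (x : T), x \in X i ->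
          #|[set y in X j | e x y]| = p i j].

Definition automorphism (T : finType) (e : rel T) (s : {perm T}) : Prop :=
  forall x y : T, e (s x) (s y) = e x y.

Definition isomorphic (T : finType) (e : rel T) (P Q : {set {set T}}) : Prop :=
  exists s : {perm T},
    automorphism e s /\ [set s @: (X : {set T}) | X in P] = Q.

Definition quotient_12_9 : 'M[nat]_2 :=
  \matrix_(i, j) (if i == j then 12 else 9).

Definition of_type n (k : nat) (X : {set johnson n 3}) : Prop :=
  forall a b : 'I_n, a != b ->
    #|[set x : 'I_n | (x \notin [set a; b]) &&
                      ([set a; b; x] \in [set val v | v in X])]| = k %[mod 3].

(* Main.v *)
(* For a part X let d(a,b) be the number of triples of X containing a and b.
   Counting the neighbours of {a,b,c} in X through its three pairs gives
   d(a,b) + d(a,c) + d(b,c) = 15 or 9 according to whether {a,b,c} is in X, and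
   summing over c gives \sum_b d(a,b) = 36.  In type 1, d takes the values 1, 4,
   7 only, so the triangle condition says that the pairs with d <> 4 form two
   disjoint cliques and that no triangle has all its values equal.  The row sums
   make 1 and 7 equally frequent at each vertex, hence (no monochromatic
   triangle) at most twice each; so both cliques have 5 vertices, and in each of
   them the 7s form a pentagon and the 1s its complement.  This determines d,
   hence X, up to a permutation of the points. *)
Require Import Defs.
From mathcomp Require Import all_boot all_fingroup all_algebra.
From mathcomp Require Import zify.

Set Implicit Arguments.
Unset Strict Implicit.
Unset Printing Implicit Defensive.

(** * Pair degrees and neighbour counts *)

Definition pair_degree n k (Y : {set johnson n k}) (a b : 'I_n) : nat :=
  #|[set y in Y | (a \in val y) && (b \in val y)]|.

Lemma pair_degreeC n k (Y : {set johnson n k}) a b :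
  pair_degree Y a b = pair_degree Y b a.
Proof. by apply: eq_card => y; rewrite !inE andbCA andbC andbA. Qed.

Lemma cards3 (T : finType) (a b c : T) :
  a != b -> a != c -> b != c -> #|[set a; b; c]| = 3.
Proof.
by move=> ab ac bc; rewrite setUC cardsU1 cards2 !inE !(eq_sym c) negb_or ac bc ab.
Qed.

Lemma cards3P (T : finType) (A : {set T}) : #|A| = 3 ->
  exists a b c, [/\ a != b, a != c, b != c & A = [set a; b; c]].
Proof.
move=> A3; have /card_gt2P[a [b [c [[aA bA cA] [ab bc ca]]]]] : 2 < #|A|.
  by rewrite A3.
rewrite eq_sym in ca; exists a, b, c; split=> //; apply/eqP.
by rewrite eq_sym eqEcard A3 cards3 // leqnn andbT !subUset !sub1set aA bA.
Qed.

(** A triple containing [a] and [b] is determined by its third point; this links pair degrees to the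
    count in [of_type]. *)
Lemma pair_degreeE n (Y : {set johnson n 3}) a b : a != b ->
  pair_degree Y a b =
  #|[set x | (x \notin [set a; b]) && ([set a; b; x] \in [set val v | v in Y])]|.
Proof.
move=> ab; rewrite /pair_degree -(card_imset _ val_inj).
set S := [set x | (x \notin _) && _].
have inj : {in S &, injective (fun x => [set a; b; x])}.
  move=> x y; rewrite !inE => /andP[xab _] _ /setP/(_ x).
  by rewrite !inE eqxx orbT (negPf xab) => /esym/eqP.
rewrite -(card_in_imset inj); apply: eq_card => A; apply/imsetP/imsetP.
  case=> y; rewrite inE => /and3P[yY ay by_] ->.
  have y3 := eqP (valP y).
  have : ~~ (val y \subset [set a; b]).
    by apply/negP=> /subset_leq_card; rewrite y3 cards2 ab.
  case/subsetPn=> x xy xab.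
  have [ax bx] : a != x /\ b != x.
    by move: xab; rewrite !inE negb_or ![x == _]eq_sym => /andP.
  have yE : val y = [set a; b; x].
    apply/eqP; rewrite eq_sym eqEcard y3 cards3 // leqnn andbT.
    by rewrite !subUset !sub1set ay by_ xy.
  by exists x; rewrite // inE xab -yE mem_imset //; apply: val_inj.
case=> x; rewrite inE => /andP[xab /imsetP[y yY yE]] ->; exists y => //.
by rewrite inE yY -yE !inE !eqxx ?orbT.
Qed.

Lemma card_setI3 (T : finType) (a b c : T) (A : {set T}) :
  a != b -> a != c -> b != c ->
  #|[set a; b; c] :&: A| = (a \in A) + (b \in A) + (c \in A).
Proof.
move=> ab ac bc; rewrite -sum1_card.
rewrite (eq_bigl (fun x => (x \in [set a; b; c]) && (x \in A))).
  rewrite big_mkcondr /= setUC big_setU1 ?big_setU1 ?big_set1 /=.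
  - by case: (a \in A); case: (b \in A); case: (c \in A).
  - by rewrite inE.
  - by rewrite !inE !(eq_sym c) negb_or ac.
by move=> x; rewrite inE.
Qed.

(** A triple adjacent to [v] contains exactly one of the pairs of [{a, b, c}], while [v] itself
    contains all three; the term [3 * (v \in Y)] accounts for the latter. *)
Lemma card_johnson_adj n (Y : {set johnson n 3}) (v : johnson n 3) a b c :
  a != b -> a != c -> b != c -> val v = [set a; b; c] ->
  #|[set y in Y | johnson_adj v y]| + 3 * (v \in Y) =
  pair_degree Y a b + pair_degree Y a c + pair_degree Y b c.
Proof.
move=> ab ac bc vE; rewrite /pair_degree.
have cardE (p : pred (johnson n 3)) :
    #|[set y in Y | p y]| = \sum_y ((y \in Y) && p y).
  by rewrite -sum1dep_card big_mkcond; apply: eq_bigr => y _; case: (_ && _).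
(* As a sum over all triples, the correction lets the identity be checked one triple [y] at a
   time. *)
have -> : 3 * (v \in Y) = \sum_y 3 * ((y \in Y) && (y == v)).
  rewrite (bigD1 v) //= eqxx andbT big1 ?addn0 // => y /negPf->.
  by rewrite andbF.
rewrite !cardE -!big_split /=; apply: eq_bigr => y _; case: (y \in Y) => //=.
have -> : (y == v) = [&& a \in val y, b \in val y & c \in val y].
  rewrite eq_sym -val_eqE eqEcard vE cards3 // (eqP (valP y)) andbT.
  by rewrite !subUset !sub1set andbA.
rewrite /johnson_adj vE card_setI3 //.
by case: (a \in _); case: (b \in _); case: (c \in _).
Qed.

Lemma mem_imset_val n k (Y : {set johnson n k}) (v : johnson n k) :
  (val v \in [set val y | y in Y]) = (v \in Y).
Proof. by rewrite (mem_imset _ _ val_inj). Qed.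

(** Write d for the degree of the pair a, b and R for row sums. Summing the triangle identity over
    the 8 other points gives 8d + (R(a) - d) + (R(b) - d) = 72 + 6d, hence R(a) + R(b) = 72. Three
    distinct points then force every row sum to be 36. *)
Lemma pair_degree_row (Y : {set johnson 10 3}) :
  (forall v, #|[set y in Y | johnson_adj v y]| = if v \in Y then 12 else 9) ->
  forall a, \sum_(b | b != a) pair_degree Y a b = 36.
Proof.
move=> degY.
have tri a b c : a != b -> a != c -> b != c ->
    pair_degree Y a b + pair_degree Y a c + pair_degree Y b c =
     if [set a; b; c] \in [set val v | v in Y] then 15 else 9.
  move=> ab ac bc; have abc3 : #|[set a; b; c]| == 3 by rewrite cards3.
  pose v : johnson 10 3 := @exist {set 'I_10} (fun x => #|x| == 3) [set a; b; c] abc3.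
  rewrite -(@card_johnson_adj _ Y v) // degY (mem_imset_val Y v).
  by case: (v \in Y).
pose row a := \sum_(b | b != a) pair_degree Y a b.
have pair_row a b : a != b -> row a + row b = 72.
  move=> ab; have ba : b != a by rewrite eq_sym.
  have card8 : \sum_(c | (c != a) && (c != b)) 1 = 8.
    rewrite sum1dep_card.
    have -> : [set c | (c != a) && (c != b)] = ~: [set a; b].
      by apply/setP=> c; rewrite !inE negb_or.
    by rewrite cardsCs setCK card_ord cards2 ab.
  have : \sum_(c | (c != a) && (c != b))
      (pair_degree Y a b + pair_degree Y a c + pair_degree Y b c) =
    \sum_(c | (c != a) && (c != b))
      (9 * 1 + 6 * ([set a; b; c] \in [set val v | v in Y])).
    apply: eq_bigr => c /andP[ca cb]; rewrite tri // 1?eq_sym //.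
    by case: ifP.
  rewrite !big_split /= -!big_distrr /= card8.
  have -> : \sum_(c | (c != a) && (c != b)) pair_degree Y a b = 8 * pair_degree Y a b.
    move/(congr1 (muln^~ (pair_degree Y a b))): card8 => /= <-.
    by rewrite big_distrl; apply: eq_bigr => c _; rewrite /= mul1n.
  have -> : \sum_(c | (c != a) && (c != b))
      ([set a; b; c] \in [set val v | v in Y] : nat) = pair_degree Y a b.
    rewrite pair_degreeE // -sum1dep_card [RHS]big_mkcond [LHS]big_mkcond /=.
    apply: eq_bigr => c _; rewrite !inE negb_or.
    by case: (_ != a); case: (_ != b) => //=; case: (_ \in _).
  rewrite {2}/row (bigD1 a ab) /= (pair_degreeC Y b a).
  rewrite /row (bigD1 b ba) /= big1_eq.
  have -> : \sum_(c | (c != b) && (c != a)) pair_degree Y b c =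
      \sum_(c | (c != a) && (c != b)) pair_degree Y b c.
    by apply: eq_bigl => c; rewrite andbC.
  move: (\sum_(c | _) _ a c) (\sum_(c | _) _ b c) (pair_degree Y a b).
  lia.
move=> a; rewrite -/(row a).
have [b [c [ab ac bc]]] : exists b c, [/\ a != b, a != c & b != c].
  have : 1 < #|[set~ a]| by rewrite cardsC1 card_ord.
  case/card_gt1P=> b [c []]; rewrite !inE ![_ == a]eq_sym => ab ac bc.
  by exists b, c.
by have := pair_row _ _ ab; have := pair_row _ _ ac; have := pair_row _ _ bc; lia.
Qed.

(** * Recovering two pentagons from the triangle condition *)

Definition signed_triangles (T : finType) (d : T -> T -> nat) : Prop :=
  [/\ forall a b, d a b = d b a,
      forall a b, a != b -> d a b \in [:: 1; 4; 7] &
      forall a b c, a != b -> a != c -> b != c ->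
        d a b + d a c + d b c \in [:: 9; 15]].

Definition level (T : finType) (d : T -> T -> nat) k a : {set T} :=
  [set b | (b != a) && (d a b == k)].

(** The pentagons live on 0..4 and 5..9 and their edges carry 7. Adding 10, a multiple of 5,
    prevents truncated subtraction, so the test says that [a] and [b] differ by 1 or -1 modulo 5. *)
Definition two_pentagons (a b : nat) : nat :=
  if (a < 5) != (b < 5) then 4
  else if (a + 10 - b) %% 5 \in [:: 1; 4] then 7 else 1.

(** The signs (d - 4)/3 lie in -1, 0, 1, and the sums 9 and 15 become -1 and 1. So every triangle
    has an odd number of nonzero signs; this parity gives both this lemma and the next one. *)
Lemma signed_triangles_neq4 (T : finType) (d : T -> T -> nat) a b c :
  signed_triangles d -> a != b -> a != c -> b != c ->
  d a b != 4 -> d a c = 4 -> d b c = 4.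
Proof.
case=> dC dval dtri ab ac bc; move: (dtri _ _ _ ab ac bc) (dval _ _ bc).
by move: (dval _ _ ab); rewrite !inE; lia.
Qed.

Lemma signed_triangles_eq4 (T : finType) (d : T -> T -> nat) a b c :
  signed_triangles d -> a != b -> a != c -> b != c ->
  d a b = 4 -> d a c = 4 -> d b c != 4.
Proof.
by case=> dC dval dtri ab ac bc; move: (dtri _ _ _ ab ac bc); rewrite !inE; lia.
Qed.

(** Two points at level [k] from [a] must be joined by 8 - [k]. Three such points would form a
    triangle of sum 3 or 21. *)
Lemma level_le2 (T : finType) (d : T -> T -> nat) k a :
  signed_triangles d -> k \in [:: 1; 7] -> #|level d k a| <= 2.
Proof.
case=> dC dval dtri k17; rewrite leqNgt; apply/negP=> /card_gt2P[x [y [z]]].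
rewrite !inE => -[[/andP[xa ax] /andP[ya ay] /andP[za az]] [xy yz zx]].
have := dtri x y z xy; rewrite eq_sym => /(_ zx yz).
have := dtri a x y; have := dtri a y z; have := dtri a x z.
rewrite ![a == _]eq_sym xa ya za [x == z]eq_sym zx xy yz.
move=> /(_ isT isT isT) + /(_ isT isT isT) + /(_ isT isT isT).
move: (dval x y xy) (dval y z yz) (dval z x zx) k17 ax ay az; rewrite !inE (dC z x); lia.
Qed.

(** Since 36 = 9 * 4, levels 1 and 7 at a vertex have a common size, at most 2, so level 4 has at
    least 5 points. For [b] at level 4 from [a], any other point at level 4 from [b] is not at level
    4 from [a]; thus 5 <= 1 + 2 * [#|level d 7 a|], and the common size at [a] is 2. *)
Lemma level_card (d : 'I_10 -> 'I_10 -> nat) a :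
  signed_triangles d -> (forall a, \sum_(b | b != a) d a b = 36) ->
  [/\ #|level d 1 a| = 2, #|level d 7 a| = 2 & #|level d 4 a| = 5].
Proof.
move=> sd row.
have [dC dval dtri] := sd.
have levelE k b : #|level d k b| = \sum_(c | c != b) (d b c == k).
  rewrite -sum1dep_card big_mkcondr /=; apply: eq_bigr => c _.
  by case: (_ == k).
have count b : #|level d 1 b| = #|level d 7 b| /\
    #|level d 4 b| = 9 - 2 * #|level d 7 b|.
  have card9 : #|level d 1 b| + #|level d 4 b| + #|level d 7 b| = 9.
    transitivity #|[set~ b]|; last by rewrite cardsC1 card_ord.
    rewrite !levelE -!big_split /= -sum1_card.
    apply: eq_big => [c|c cb]; first by rewrite !inE.
    by move: (dval b c); rewrite eq_sym cb !inE => /(_ isT)/or3P[] /eqP->.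
  have : #|level d 1 b| + 4 * #|level d 4 b| + 7 * #|level d 7 b| = 36.
    rewrite -(row b) !levelE !big_distrr -!big_split /=.
    apply: eq_bigr => c cb.
    by move: (dval b c); rewrite eq_sym cb !inE => /(_ isT)/or3P[] /eqP->.
  lia.
have [c17 c4] := count a; have a7 := level_le2 a sd (isT : 7 \in [:: 1; 7]).
have /card_gt0P[b] : 0 < #|level d 4 a| by lia.
rewrite inE => /andP[ba /eqP ab4].
have /subset_leq_card leU : level d 4 b \subset a |: level d 1 a :|: level d 7 a.
  apply/subsetP=> c; rewrite !inE => /andP[cb /eqP bc4].
  have [//|ca] := eqVneq c a.
  have ac : d a c != 4.
    have := @signed_triangles_eq4 _ _ b a c sd; rewrite ba eq_sym cb eq_sym ca.
    by rewrite (dC b a) => ->.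
  have := dval a c; rewrite eq_sym ca !inE => /(_ isT).
  by rewrite (negPf ac).
have le4 : #|level d 4 b| <= 1 + #|level d 1 a| + #|level d 7 a|.
  apply: leq_trans leU _; apply: leq_trans (leq_card_setU _ _) _.
  by rewrite leq_add2r (leq_trans (leq_card_setU _ _)) ?cards1.
have [_ b4] := count b; have b7 := level_le2 b sd (isT : 7 \in [:: 1; 7]).
move: c17 c4 a7 b4 b7 le4; clear.
move: #|level d 1 a| #|level d 7 a| #|level d 4 a| #|level d 4 b| #|level d 7 b|.
by move=> x y z w t *; split; lia.
Qed.

Lemma pentagon (T : finType) (d : T -> T -> nat) a :
  signed_triangles d -> #|level d 1 a| = 2 -> #|level d 7 a| = 2 ->
  exists l : seq T,
    [/\ size l = 5, uniq l, forall x, (x \in l) = (x == a) || (d a x != 4) &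
        forall i j, i < 5 -> j < 5 -> i != j ->
          d (nth a l i) (nth a l j) = two_pentagons i j].
Proof.
move=> sd /eqP/cards2P[p [q [pq L1]]] /eqP/cards2P[b [c [bc L7]]].
have [dC dval dtri] := sd.
have [pa ap] : p != a /\ d a p = 1.
  by have := set21 p q; rewrite -L1 inE => /andP[-> /eqP].
have [qa aq] : q != a /\ d a q = 1.
  by have := set22 p q; rewrite -L1 inE => /andP[-> /eqP].
have [ba ab] : b != a /\ d a b = 7.
  by have := set21 b c; rewrite -L7 inE => /andP[-> /eqP].
have [ca ac] : c != a /\ d a c = 7.
  by have := set22 b c; rewrite -L7 inE => /andP[-> /eqP].
have neq x y : d a x = 7 -> d a y = 1 -> x != y.
  by move=> ax ay; apply/eqP=> xy; rewrite -xy ax in ay.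
have [abp acp abq acq] :=
  And4 (neq _ _ ab ap) (neq _ _ ac ap) (neq _ _ ab aq) (neq _ _ ac aq).
have dbc : d b c = 1.
  by move: (dtri a b c) (dval b c bc); rewrite !(eq_sym a) ba ca bc ab ac !inE;
    move=> /(_ isT isT isT); clear; lia.
have dpq : d p q = 7.
  by move: (dtri a p q) (dval p q pq); rewrite !(eq_sym a) pa qa pq ap aq !inE;
    move=> /(_ isT isT isT); clear; lia.
have d17 x y : x != a -> y != a -> x != y -> d a x = 7 -> d a y = 1 ->
    (d x y == 1) || (d x y == 7).
  move=> xa ya xy ax ay; move: (dtri a x y).
  by rewrite !(eq_sym a) xa ya ax ay !inE => /(_ isT isT xy); clear; lia.
(* At least one of [d b p], [d b q] is 7: if both were 1, then [d b c = 1] would force [d c p] and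
   [d c q] to be 7, making [c], [p], [q] a triangle of 7s. *)
wlog bp : p q L1 pq pa ap qa aq abp acp abq acq dpq / d b p = 7.
  move=> IH; have [bp|bp] := eqVneq (d b p) 7; first exact: (IH p q).
  apply: (IH q p) => //; [by rewrite setUC | by rewrite eq_sym | by rewrite dC |].
  have [tp tq] := (dtri _ _ _ bc abp acp, dtri _ _ _ acp acq pq).
  move: (d17 _ _ ba pa abp ab ap) (d17 _ _ ba qa abq ab aq) bp tp tq.
  move: (d17 _ _ ca pa acp ac ap) (dtri _ _ _ bc abq acq).
  by rewrite dpq dbc !inE; clear; lia.
have [bq cp cq] : [/\ d b q = 1, d c p = 1 & d c q = 7].
  have := dtri _ _ _ bc abq acq.
  move: (d17 _ _ ba qa abq ab aq) (dtri _ _ _ acp acq pq) (dtri _ _ _ abp abq pq).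
  move: (d17 _ _ ca pa acp ac ap) (d17 _ _ ca qa acq ac aq).
  by rewrite dpq dbc bp !inE; clear => *; split; lia.
(* This is the cyclic order of the 7s, so that list positions match the vertices 0..4 of the
   model. *)
exists [:: a; b; p; q; c]; split=> //.
- rewrite /= !inE !negb_or !(eq_sym a) !(eq_sym _ c) ba pa qa ca.
  by rewrite abp abq pq acp acq (eq_sym c b) bc.
- move=> x; have [->|xa] := eqVneq x a; first by rewrite inE eqxx.
  have : (x \in level d 1 a :|: level d 7 a) = (d a x != 4).
    rewrite !inE xa; move: (dval a x); rewrite eq_sym xa => /(_ isT).
    by rewrite !inE => /or3P[] /eqP->.
  rewrite L1 L7 => <-; rewrite !inE (negPf xa) /=.
  by case: (x == b); case: (x == p); case: (x == q); case: (x == c).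
- by move=> [|[|[|[|[|i]]]]] [|[|[|[|[|j]]]]] //= _ _ _; rewrite // dC.
Qed.

(** Apply [pentagon] at [a] and at some [b] with [d a b = 4]. All values between the two resulting
    lists are 4, so the lists are disjoint and together enumerate the ten points. *)
Lemma two_pentagonsP (d : 'I_10 -> 'I_10 -> nat) :
  signed_triangles d -> (forall a, \sum_(b | b != a) d a b = 36) ->
  exists s : {perm 'I_10},
    forall a b, a != b -> d (s a) (s b) = two_pentagons a b.
Proof.
move=> sd row; have [dC dval dtri] := sd.
have card_level := level_card _ sd row.
pose a : 'I_10 := ord0.
have [a1 a7 a4] := card_level a.
have /card_gt0P[b] : 0 < #|level d 4 a| by rewrite a4.
rewrite inE => /andP[ba /eqP ab]; have [b1 b7 _] := card_level b.
have [l [sl ul meml dl]] := pentagon sd a1 a7.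
have [m [sm um memm dm]] := pentagon sd b1 b7.
(* [signed_triangles_neq4] is used twice: to move one end of the pair from [a] to [x], then the
   other from [b] to [y]. *)
have cross x y : x \in l -> y \in m -> d x y = 4.
  have xb4 z : z \in l -> z != b /\ d z b = 4.
    rewrite meml; have [->|za] := eqVneq z a; first by split; rewrite // eq_sym.
    move=> /= az; have zb : z != b by apply: contraNneq az => ->; rewrite ab.
    by split=> //; apply: (signed_triangles_neq4 sd _ _ _ az) => //; rewrite eq_sym.
  move=> /xb4[xb dxb]; rewrite memm; have [->|yb] // := eqVneq y b.
  move=> /= bY; have xy : x != y by apply: contraNneq bY => <-; rewrite dC dxb.
  rewrite dC; apply: (signed_triangles_neq4 sd _ _ _ bY); rewrite 1?eq_sym //.
  by rewrite dC.
have ulm : uniq (l ++ m).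
  rewrite cat_uniq ul um andbT /=; apply/hasPn=> x xm; apply/negP=> xl.
  have := cross _ b xl; rewrite memm eqxx => /(_ isT) xb.
  move: xm; rewrite memm dC xb eqxx orbF => /eqP xb'.
  by move: xl; rewrite xb' meml (negPf ba) ab.
pose f (i : 'I_10) := nth a (l ++ m) i.
have f_inj : injective f.
  move=> i j /eqP; rewrite nth_uniq ?size_cat ?sl ?sm //.
  by move/eqP/val_inj.
exists (perm f_inj) => i j ij; rewrite !permE /f !nth_cat sl.
have lt5 (k : 'I_10) : 5 <= k -> k - 5 < 5 by move: (ltn_ord k); lia.
have ml k : k < 5 -> nth a l k \in l by move=> k5; rewrite mem_nth ?sl.
have mm k : k < 5 -> nth a m k \in m by move=> k5; rewrite mem_nth ?sm.
case: ltnP => i5; case: ltnP => j5.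
- exact: dl.
- by rewrite cross ?ml ?mm ?lt5 // /two_pentagons i5 ltnNge j5.
- by rewrite dC cross ?ml ?mm ?lt5 // /two_pentagons j5 ltnNge i5.
(* [f] reads [m] with default [a], [dm] with default [b]; all positions are below 5, so the default
   is immaterial. Shifting both positions by 5 preserves their difference. *)
- rewrite !(set_nth_default b a) ?sm ?lt5 // dm ?lt5 //.
    rewrite /two_pentagons !lt5 // ltnNge i5 ltnNge j5 /=.
    by have -> : i - 5 + 10 - (j - 5) = i + 10 - j by lia.
  by apply: contraNneq ij => ij; apply/eqP/val_inj; rewrite /=; lia.
Qed.

(** * Colorings as a set and its complement, and permutations of the points *)

Lemma perfect_coloring_part (T : finType) (e : rel T) (P : {set {set T}}) Y :
  perfect_coloring e quotient_12_9 P -> Y \in P ->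
  P = [set Y; ~: Y] /\
  forall v, #|[set y in Y | e v y]| = if v \in Y then 12 else 9.
Proof.
case=> /and3P[/eqP covP /trivIsetP trivP _] [X [X_inj PE degX]].
have XP i : X i \in P by rewrite PE imset_f.
rewrite {1}PE => /imsetP[i _ ->].
have XC j : j != i -> X j = ~: X i.
  move=> ji; apply/eqP; rewrite eqEsubset -disjoints_subset trivP //=; last first.
    by rewrite (inj_eq X_inj).
  apply/subsetP=> v; rewrite inE => vi.
  have : v \in cover P by rewrite covP inE.
  case/bigcupP=> B; rewrite PE => /imsetP[k _ ->] vk.
  suff -> : j = k by [].
  have ki : k != i by apply: contraNneq vi => <-.
  apply/val_inj; move: ji ki; rewrite -!val_eqE /=.
  by move: (ltn_ord i) (ltn_ord j) (ltn_ord k); lia.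
have [j ji] : exists j, j != i.
  (* Reversal exchanges the two elements of ['I_2]. *)
  by exists (rev_ord i); rewrite -val_eqE /=; move: (ltn_ord i); lia.
split=> [|v].
  apply/setP=> B; rewrite !inE; apply/idP/orP.
    rewrite PE => /imsetP[k _ ->]; have [->|ki] := eqVneq k i; first by left.
    by right; rewrite (XC k).
  by case=> /eqP->; rewrite -?(XC j).
case: ifP => vi; first by rewrite (degX i i) // mxE eqxx.
have vj : v \in X j by rewrite XC // inE vi.
by rewrite (degX j i) // mxE (negPf ji).
Qed.

Lemma perfect_coloringC (T : finType) (e : rel T) (Y : {set T}) (v0 : T) :
  (forall v, #|[set y in Y | e v y]| = if v \in Y then 12 else 9) ->
  (forall v, #|[set y in ~: Y | e v y]| = if v \in Y then 9 else 12) ->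
  perfect_coloring e quotient_12_9 [set Y; ~: Y].
Proof.
move=> degY degC.
(* Parts of a partition must be nonempty; the vertex [v0] has 9 or 12 neighbours in each. *)
have nonempty (A : {set T}) : 0 < #|[set y in A | e v0 y]| -> A != set0.
  by case/card_gt0P=> y; rewrite inE => /andP[yA _]; apply/set0Pn; exists y.
have Y0 : Y != set0 by apply: nonempty; rewrite degY; case: ifP.
have C0 : ~: Y != set0 by apply: nonempty; rewrite degC; case: ifP.
have YC : Y != ~: Y.
  apply: contraNneq Y0 => YE; apply/eqP/setP=> y; move/setP/(_ y): YE.
  by rewrite !inE; case: (y \in Y).
split.
  apply/and3P; split.
  - by rewrite /cover bigcup_setU !big_set1 setUCr.
  - apply/trivIsetP=> A B; rewrite !inE.
    move=> /orP[]/eqP-> /orP[]/eqP->; rewrite ?eqxx // => _.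
      by rewrite disjoints_subset setCK.
    by rewrite disjoints_subset.
  - by rewrite !inE !(eq_sym set0) negb_or Y0.
have I2 (k : 'I_2) : k = ord0 \/ k = ord_max.
  by have := ltn_ord k; case: (posnP k) => k0 k2; [left | right]; apply/val_inj => /=; lia.
exists (fun i : 'I_2 => if i == ord0 then Y else ~: Y); split.
- move=> i j; case: (I2 i) => ->; case: (I2 j) => -> //= /eqP.
    by rewrite (negPf YC).
  by rewrite eq_sym (negPf YC).
- apply/setP=> B; rewrite !inE; apply/orP/imsetP => [[]/eqP->|[i _ ->]].
  + by exists ord0.
  + by exists ord_max.
  + by case: ifP; [left | right].
move=> i j v.
case: (I2 i) => ->; case: (I2 j) => ->; rewrite mxE /= ?degY ?degC.
- by move=> ->.
- by move=> ->.
- by rewrite inE => /negPf->.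
- by rewrite inE => /negPf->.
Qed.

Lemma johnson_permP n k (s : {perm 'I_n}) :
  exists2 t : {perm johnson n k},
    automorphism (@johnson_adj n k) t & forall v, val (t v) = s @: val v.
Proof.
have card_s (v : johnson n k) : #|s @: val v| == k.
  by rewrite card_imset ?(valP v) //; apply: perm_inj.
pose f v : johnson n k := @exist {set 'I_n} (fun x => #|x| == k) _ (card_s v).
have f_inj : injective f.
  by move=> u v /(congr1 val) /= /(imset_inj (@perm_inj _ s)) /val_inj.
have fE v : val (perm f_inj v) = s @: val v by rewrite permE.
exists (perm f_inj) => // x y; rewrite /johnson_adj !fE.
by rewrite -imsetI ?card_imset //; [apply: perm_inj | move=> ? ? _ _; apply: perm_inj].
Qed.

Lemma imsetC_perm (T : finType) (s : {perm T}) (A : {set T}) :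
  s @: (~: A) = ~: (s @: A).
Proof.
apply/setP=> x; rewrite -(permKV s x) inE !(mem_imset _ _ (@perm_inj _ s)).
by rewrite inE.
Qed.

(** * The model coloring *)

Lemma big_set3 (T : finType) (F : T -> nat) a b c :
  a != b -> a != c -> b != c ->
  \sum_(x in [set a; b; c]) F x = F a + F b + F c.
Proof.
move=> ab ac bc; rewrite setUC !big_setU1 ?big_set1 ?inE //=.
  by rewrite addnC.
by rewrite !(eq_sym c) negb_or ac.
Qed.

(** Turns a cardinal over ordinals into a count on a concrete list, which can be evaluated. *)
Lemma card_ord_iota n (P : pred nat) : #|[set x : 'I_n | P x]| = count P (iota 0 n).
Proof. by rewrite -sum1dep_card -(big_mkord P (fun=> 1)) sum1_count /index_iota subn0. Qed.

(* two_pentagons x x = 1, so 33 = 3 + 2 * 15. *)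
Definition pentagon_part : {set johnson 10 3} :=
  [set v : johnson 10 3 |
    \sum_(a in val v) \sum_(b in val v) two_pentagons a b == 33].

Lemma two_pentagonsC a b : a < 10 -> b < 10 -> two_pentagons a b = two_pentagons b a.
Proof.
move=> a10 b10; have : all (fun a => all (fun b => two_pentagons a b == two_pentagons b a)
    (iota 0 10)) (iota 0 10) by [].
move/allP/(_ a); rewrite mem_iota => /(_ a10)/allP/(_ b).
by rewrite mem_iota => /(_ b10)/eqP.
Qed.

(** A finite check over 0..9. The counts express self-consistency: among the 8 possible third
    points, the number giving sum 15 is the value of the pair itself. *)
Lemma two_pentagons_count (a b : 'I_10) : a != b ->
  [/\ two_pentagons a b \in [:: 1; 4; 7],
      count (fun x : nat => [&& x != a, x != b &
        two_pentagons a b + two_pentagons a x + two_pentagons b x == 15])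
        (iota 0 10) = two_pentagons a b,
      count (fun x : nat => [&& x != a, x != b &
        two_pentagons a b + two_pentagons a x + two_pentagons b x != 15])
        (iota 0 10) = 8 - two_pentagons a b &
      forall c : 'I_10, a != c -> b != c ->
      two_pentagons a b + two_pentagons a c + two_pentagons b c \in [:: 9; 15]].
Proof.
move=> ab.
have : all (fun a => all (fun b => (a != b) ==>
    [&& two_pentagons a b \in [:: 1; 4; 7],
      count (fun x : nat => [&& x != a, x != b &
        two_pentagons a b + two_pentagons a x + two_pentagons b x == 15])
        (iota 0 10) == two_pentagons a b,
      count (fun x : nat => [&& x != a, x != b &
        two_pentagons a b + two_pentagons a x + two_pentagons b x != 15])
        (iota 0 10) == 8 - two_pentagons a b &
      all (fun c => (a != c) ==> (b != c) ==>
        (two_pentagons a b + two_pentagons a c + two_pentagons b c \in [:: 9; 15]))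
        (iota 0 10)]) (iota 0 10)) (iota 0 10) by vm_compute.
move/allP/(_ (val a)); rewrite mem_iota => /(_ (ltn_ord a)).
move/allP/(_ (val b)); rewrite mem_iota => /(_ (ltn_ord b)).
move/implyP/(_ ab)/and4P=> [t147 /eqP cntE /eqP cntC /allP tri].
split=> // c ac bc; have := tri (val c); rewrite mem_iota => /(_ (ltn_ord c)).
by move/implyP/(_ ac)/implyP/(_ bc).
Qed.

Lemma mem_pentagon_part (v : johnson 10 3) a b c :
  a != b -> a != c -> b != c -> val v = [set a; b; c] ->
  (v \in pentagon_part) =
  (two_pentagons a b + two_pentagons a c + two_pentagons b c == 15).
Proof.
move=> ab ac bc vE; rewrite inE vE !big_set3 //.
have tt x : two_pentagons x x = 1.
  by rewrite /two_pentagons eqxx /= addnC addnK.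
rewrite !tt (two_pentagonsC (ltn_ord b) (ltn_ord a)).
rewrite (two_pentagonsC (ltn_ord c) (ltn_ord a)).
rewrite (two_pentagonsC (ltn_ord c) (ltn_ord b)); lia.
Qed.

Lemma pair_degree_pentagon a b : a != b ->
  pair_degree pentagon_part a b = two_pentagons a b /\
  pair_degree (~: pentagon_part) a b = 8 - two_pentagons a b.
Proof.
move=> ab; have [_ cntE cntC _] := two_pentagons_count ab.
have mem (Y : {set johnson 10 3}) c : c != a -> c != b ->
    exists2 v : johnson 10 3,
      ([set a; b; c] \in [set val v | v in Y]) = (v \in Y) &
      (v \in pentagon_part) =
        (two_pentagons a b + two_pentagons a c + two_pentagons b c == 15).
  rewrite ![c == _]eq_sym => ac bc.
  have abc3 : #|[set a; b; c]| == 3 by rewrite cards3.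
  pose v : johnson 10 3 := @exist {set 'I_10} (fun x => #|x| == 3) _ abc3.
  by exists v; [exact: (mem_imset_val Y v) | rewrite (mem_pentagon_part ab ac bc)].
split.
  rewrite pair_degreeE // -cntE -card_ord_iota; apply: eq_card => c.
  rewrite !inE negb_or -andbA; have [->|ca] := eqVneq c a; first by rewrite !eqxx.
  have [->|cb] := eqVneq c b; first by rewrite !eqxx !andbF.
  have [v -> ->] := mem pentagon_part c ca cb.
  by rewrite (ca : (c != a :> nat)) (cb : (c != b :> nat)).
rewrite pair_degreeE // -cntC -card_ord_iota; apply: eq_card => c.
rewrite !inE negb_or -andbA; have [->|ca] := eqVneq c a; first by rewrite !eqxx.
have [->|cb] := eqVneq c b; first by rewrite !eqxx !andbF.
have [v -> <-] := mem (~: pentagon_part) c ca cb.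
by rewrite inE (ca : (c != a :> nat)) (cb : (c != b :> nat)).
Qed.

(** By [card_johnson_adj], a triple with value sum 15 has 15 - 3 = 12 neighbours in the part, and
    one with sum 9 has 9. For the complement the sum s becomes 24 - s, which exchanges 15 and 9. *)
Lemma pentagon_coloring :
  perfect_coloring (@johnson_adj 10 3) quotient_12_9 [set pentagon_part; ~: pentagon_part].
Proof.
have v0 : johnson 10 3.
  exists [set inord 0; inord 1; inord 2].
  by rewrite cards3 // -val_eqE /= !inordK.
have deg v : #|[set y in pentagon_part | johnson_adj v y]| =
      (if v \in pentagon_part then 12 else 9) /\
    #|[set y in ~: pentagon_part | johnson_adj v y]| =
      (if v \in pentagon_part then 9 else 12).
  have [a [b [c [ab ac bc vE]]]] := cards3P (eqP (valP v)).
  have := card_johnson_adj pentagon_part ab ac bc vE.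
  have := card_johnson_adj (~: pentagon_part) ab ac bc vE.
  have [-> ->] := pair_degree_pentagon ab.
  have [-> ->] := pair_degree_pentagon ac.
  have [-> ->] := pair_degree_pentagon bc.
  have [tab _ _ /(_ c ac bc) tri] := two_pentagons_count ab.
  have [tac _ _ _] := two_pentagons_count ac.
  have [tbc _ _ _] := two_pentagons_count bc.
  rewrite inE (mem_pentagon_part ab ac bc vE); move: tab tac tbc tri.
  rewrite !inE; move: (two_pentagons a b) (two_pentagons a c) (two_pentagons b c).
  move: #|_| #|_| => m n x y z; clear.
  by case: (x + y + z =P 15) => /= *; split; lia.
by apply: (perfect_coloringC v0) => v; case: (deg v).
Qed.

(** * Uniqueness *)

Lemma pair_degree_signed (Y : {set johnson 10 3}) : of_type 1 Y ->
  (forall v, #|[set y in Y | johnson_adj v y]| = if v \in Y then 12 else 9) ->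
  signed_triangles (pair_degree Y).
Proof.
move=> typeY degY; split=> [a b|a b ab|a b c ab ac bc].
- exact: pair_degreeC.
- have := typeY a b ab; rewrite -pair_degreeE //.
  have : pair_degree Y a b <= 8.
    rewrite pair_degreeE // (leq_trans (_ : _ <= #|~: [set a; b]|)) //.
      by apply: subset_leq_card; apply/subsetP=> x; rewrite !inE => /andP[].
    by rewrite cardsCs setCK card_ord cards2 ab.
  (* Only 1, 4 and 7 are at most 8 and congruent to 1 modulo 3. *)
  rewrite !inE; lia.
- have abc3 : #|[set a; b; c]| == 3 by rewrite cards3.
  pose v : johnson 10 3 := @exist {set 'I_10} (fun x => #|x| == 3) _ abc3.
  rewrite -(@card_johnson_adj _ Y v) // degY.
  by case: (v \in Y).
Qed.

Theorem theorem13 :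
  exists P : {set {set johnson 10 3}},
    [/\ perfect_coloring (@johnson_adj 10 3) quotient_12_9 P,
        exists2 X : {set johnson 10 3}, X \in P & of_type 1 X &
        forall Q : {set {set johnson 10 3}},
          perfect_coloring (@johnson_adj 10 3) quotient_12_9 Q ->
          (exists2 X : {set johnson 10 3}, X \in Q & of_type 1 X) ->
          isomorphic (@johnson_adj 10 3) P Q].
Proof.
exists [set pentagon_part; ~: pentagon_part]; split.
- exact: pentagon_coloring.
- exists pentagon_part; first by rewrite !inE eqxx.
  move=> a b ab; rewrite -pair_degreeE //.
  have [-> _] := pair_degree_pentagon ab.
  have [tab _ _ _] := two_pentagons_count ab.
  by move: tab; rewrite !inE => /or3P[]/eqP->.
move=> Q perfQ [Y YQ typeY].
have [-> degY] := perfect_coloring_part perfQ YQ.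
have [s sE] := two_pentagonsP (pair_degree_signed typeY degY) (pair_degree_row degY).
have [t t_auto tE] := johnson_permP 3 s.
(* By the choice of [s], the pair degrees of [Y] on [t v] are the model values on [v]. Their sum is
   15 exactly when [t v] is in [Y], and also exactly when [v] is in [pentagon_part]. *)
have tY : t @: pentagon_part = Y.
  apply/setP=> u; rewrite -(permKV t u) mem_imset; last exact: perm_inj.
  move: (t^-1%g u) => v.
  have [a [b [c [ab ac bc vE]]]] := cards3P (eqP (valP v)).
  rewrite (mem_pentagon_part ab ac bc vE).
  have tvE : val (t v) = [set s a; s b; s c].
    by rewrite tE vE !imsetU !imset_set1.
  have := @card_johnson_adj _ Y (t v) (s a) (s b) (s c).
  rewrite !(inj_eq (@perm_inj _ s)) => /(_ ab ac bc tvE).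
  by rewrite degY !sE //; case: (t v \in Y) => /= <-.
exists t; split=> //.
by rewrite imsetU1 imset_set1 imsetC_perm tY.
Qed.
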